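(* Let $\alpha$ and $\gamma$ be two compositions of $n$ such that $\alpha\le\gamma$. The non-commutative Macdonald polynomials $\mathbf{H}_\alpha(A;q,t)$ and $\widetilde{\mathbf{H}}_\alpha(A;q,t)$ are $\gamma$-Schur positive. More precisely, $$\mathbf{H}_\alpha(A;q,t)=\sum_{\beta\le\gamma}t^{c(\alpha,\beta^c)}\,q^{c(\alpha',\overleftarrow{\beta})}\,\mathbf{R}_\beta^{(\gamma)}(A;t)$$ and $$\widetilde{\mathbf{H}}_\alpha(A;q,t)=\sum_{\beta\le\gamma}t^{c(\alpha,\beta)}\,q^{c(\alpha',\overleftarrow{\beta})}\,\mathbf{R}^{(\gamma)}_\beta\left(A;\frac1t\right).$$
   Context: A composition $\alpha=(\alpha_1,\ldots,\alpha_{l(\alpha)})$ of $n$ (written $\alpha\models n$) is a sequence of positive integers with sum $n$; $l(\alpha)$ is its length. Its descent set is $D(\alpha)=\{\alpha_1,\alpha_1+\alpha_2,\ldots,\alpha_1+\cdots+\alpha_{l(\alpha)-1}\}\subseteq\{1,\ldots,n-1\}$; this gives a bijection between compositions of $n$ and subsets of $\{1,\ldots,n-1\}$. Refinement order on compositions of $n$: $\alpha\le\beta$ iff $D(\beta)\subseteq D(\alpha)$. The complement $\alpha^c$ is the composition of $n$ with $D(\alpha^c)=\{1,\ldots,n-1\}\setminus D(\alpha)$; the reverse is $\overleftarrow{\alpha}=(\alpha_{l(\alpha)},\ldots,\alpha_1)$, so $D(\overleftarrow{\alpha})=\{n-i:i\in D(\alpha)\}$; the conjugate is $\alpha'=\overleftarrow{\alpha^c}$.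 For compositions $\alpha,\beta$ of $n$, $c(\alpha,\beta)=\sum_{i\in D(\alpha)\cap D(\beta)}i$ and $n(\alpha)=\sum_{i\in D(\alpha)}i$. $\mathbf{Sym}=\mathbb{C}(q,t)\langle\mathbf{h}_1,\mathbf{h}_2,\ldots\rangle$ is the free associative algebra of non-commutative symmetric functions; $\mathbf{h}_\alpha(A)=\mathbf{h}_{\alpha_1}\cdots\mathbf{h}_{\alpha_{l(\alpha)}}$. The ribbon Schur functions are $\mathbf{R}_\alpha(A)=\sum_{\beta\ge\alpha}(-1)^{l(\alpha)-l(\beta)}\mathbf{h}_\beta(A)$. Non-commutative Macdonald polynomials, for $\alpha\models n$: $\mathbf{H}_\alpha(A;q,t)=\sum_{\beta\models n}t^{c(\alpha,\beta^c)}q^{c(\alpha',\overleftarrow{\beta})}\mathbf{R}_\beta(A)$. Modified version: $\widetilde{\mathbf{H}}_\alpha(A;q,t)=t^{n(\alpha)}\mathbf{H}_\alpha(A;q,1/t)=\sum_{\beta\models n}t^{c(\alpha,\beta)}q^{c(\alpha',\overleftarrow{\beta})}\mathbf{R}_\beta(A)$. For compositions $\alpha\le\gamma$ of $n$, the $\gamma$-ribbon Schur function (also called $\gamma$-Schur function) is $$\mathbf{R}_\alpha^{(\gamma)}(A;t)=\sum_{\substack{\beta\ge\alpha\\ D(\alpha)\setminus D(\beta)\subseteq D(\gamma)}}t^{c(\alpha,\beta^c)}\mathbf{R}_\beta(A),$$ and $\mathbf{R}_\alpha^{(\gamma)}(A;1/t)$ is obtained by replacing $t$ by $1/t$. ''$\gamma$-Schur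 positive'' means that the expansion in the $\gamma$-Schur functions (with parameter $t$ for $\mathbf{H}_\alpha$, with parameter $1/t$ for $\widetilde{\mathbf{H}}_\alpha$) has coefficients that are polynomials in $q,t$ with nonnegative integer coefficients. *)

(* Defs.v *)
From HB Require Import structures.
From mathcomp Require Import all_boot all_order all_algebra.
From mathcomp Require Import fraction complex reals.
From mathcomp.multinomials Require Import mpoly.

Set Implicit Arguments.
Unset Strict Implicit.
Unset Printing Implicit Defensive.

Import GRing.Theory.

Local Open Scope ring_scope.

Definition Cqt (R : realType) : fieldType := {fraction {mpoly R[i][2]}}.
Definition qvar (R : realType) : Cqt R := tofrac 'X_ord0.
Definition tvar (R : realType) : Cqt R := tofrac 'X_ord_max.

Definition nonneg_int_poly (R : realType) (x : Cqt R) : Prop :=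
  exists2 p : {mpoly R[i][2]},
    x = tofrac p & forall m, exists k : nat, p@_m = k%:R.

(* Imported only now: its notations hide those of mpoly. *)
From mathcomp.multinomials Require Import monalg.

Local Close Scope ring_scope.

Definition is_composition (n : nat) (s : seq nat) : bool :=
  all (leq 1) s && (sumn s == n).

Record composition (n : nat) :=
  Composition { parts :> seq nat; partsP : is_composition n parts }.

HB.instance Definition _ (n : nat) := [isSub for @parts n].
HB.instance Definition _ (n : nat) := [Countable of composition n by <:].

(* a_1, a_1 + a_2, ..., a_1 + ... + a_l, including the last sum n. *)
Definition partial_sums (s : seq nat) : seq nat := scanl addn 0 s.

(* The last partial sum n is excluded because it is not in 'I_n, and 0 is
   never a partial sum; hence this is a subset of {1, ..., n-1}. *)
Definition descents (n : nat) (a : composition n) : {set 'I_n} :=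
  [set i : 'I_n | (i : nat) \in partial_sums a].

(* The parts of the composition of n with descent set
   {1 <= i <= n-1 | P i}: the successive differences of these i, followed
   by n, starting from 0. *)
Definition parts_of_descents (n : nat) (P : pred nat) : seq nat :=
  pairmap (fun x y => y - x) 0 [seq i <- iota 1 n | P i || (i == n)].

Lemma pairmap_subn (x : nat) (s : seq nat) : path ltn x s ->
  [/\ all (leq 1) (pairmap (fun x y => y - x) x s),
      sumn (pairmap (fun x y => y - x) x s) = last x s - x
    & scanl addn x (pairmap (fun x y => y - x) x s) = s].
Proof.
elim: s x => [|y s IHs] x /=; first by rewrite subnn.
move=> /andP[lt_xy path_s]; have [-> -> eq_s] := IHs y path_s.
have le_ys : y <= last y s.
  have: all (ltn y) s by exact: order_path_min ltn_trans path_s.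
  by case: (lastP s) => //= s' z; rewrite all_rcons last_rcons => /andP[/ltnW].
have le_xy := ltnW lt_xy; split; first by rewrite subn_gt0 lt_xy.
  by rewrite -[last y s](subnKC le_ys) addKn -addnBAC.
by rewrite subnKC // eq_s.
Qed.

Lemma path_cuts (n : nat) (P : pred nat) : path ltn 0 (filter P (iota 1 n)).
Proof.
rewrite path_min_sorted; first exact: (sorted_filter ltn_trans _ (iota_ltn_sorted _ _)).
by apply/allP=> i; rewrite mem_filter mem_iota => /and3P[].
Qed.

Lemma parts_of_descentsP (n : nat) (P : pred nat) :
  is_composition n (parts_of_descents n P).
Proof.
rewrite /is_composition /parts_of_descents.
have [-> -> _] := pairmap_subn (path_cuts n (fun i => P i || (i == n))).
case: n => [|n] //.
have -> : iota 1 n.+1 = iota 1 n ++ [:: n.+1] by have := iotaD 1 n 1; rewrite addn1 add1n.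
by rewrite filter_cat last_cat /= eqxx orbT subn0 /=.
Qed.

Definition of_descents (n : nat) (P : pred nat) : composition n :=
  Composition (parts_of_descentsP n P).

Lemma partial_sums_of_descents (n : nat) (P : pred nat) :
  partial_sums (of_descents n P) = [seq i <- iota 1 n | P i || (i == n)].
Proof.
by have [] := pairmap_subn (path_cuts n (fun i => P i || (i == n))).
Qed.

Lemma descents_of_descents (n : nat) (P : pred nat) :
  descents (of_descents n P) = [set i : 'I_n | (0 < i) && P i].
Proof.
apply/setP=> i; rewrite !inE partial_sums_of_descents mem_filter mem_iota.
by rewrite add1n ltnS (ltnW (ltn_ord i)) (ltn_eqF (ltn_ord i)) orbF andbT andbC.
Qed.

Lemma scanl_addnP (x : nat) (s : seq nat) : all (leq 1) s ->
  [/\ path ltn x (scanl addn x s), last x (scanl addn x s) = x + sumn s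
    & pairmap (fun x y => y - x) x (scanl addn x s) = s].
Proof.
elim: s x => [|y s IHs] x /=; first by rewrite addn0.
move=> /andP[y_gt0 /(IHs (x + y))[-> -> ->]].
by rewrite addnA addKn -[X in X < _]addn0 ltn_add2l y_gt0.
Qed.

Lemma partial_sums_filter (n : nat) (a : composition n) :
  partial_sums a = [seq i <- iota 1 n | (i \in partial_sums a) || (i == n)].
Proof.
have /andP[a_gt0 /eqP sum_a] := partsP a.
have [path_a last_a _] := scanl_addnP 0 a_gt0; rewrite sum_a add0n in last_a.
apply: (irr_sorted_eq ltn_trans ltnn).
- exact: path_sorted path_a.
- exact: path_sorted (path_cuts n (fun i => (i \in partial_sums a) || (i == n))).
move=> i; rewrite mem_filter mem_iota add1n ltnS.
apply/idP/idP => [ai|].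
  rewrite ai /=; have /allP/(_ _ ai) -> := order_path_min ltn_trans path_a.
  rewrite -[n in _ <= n]last_a; have: sorted leq (0 :: scanl addn 0 a).
    by rewrite /=; apply: sub_path path_a => x y /ltnW.
  move: ai; rewrite /partial_sums; case/splitPr => s1 s2 /=.
  rewrite cat_path /= last_cat /= => /and3P[_ _].
  rewrite path_sortedE; last exact: leq_trans.
  move=> /andP[/allP all_s2 _]; case: (lastP s2) all_s2 => //= s' z.
  by rewrite last_rcons; apply; rewrite mem_rcons mem_head.
case/andP=> /orP[//|/eqP ->] /andP[n_gt0 _].
rewrite -{1}last_a /partial_sums.
by move: last_a; case: (scanl _ _ _) => [/= n0|x s _]; [rewrite -n0 in n_gt0 | exact: mem_last].
Qed.

Lemma descentsK (n : nat) :
  cancel (@descents n)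
    (fun S => of_descents n (fun i => [exists j in S, (j : nat) == i])).
Proof.
move=> a; apply: val_inj => /=; rewrite /parts_of_descents.
have /andP[a_gt0 _] := partsP a; have [_ _ eq_a] := scanl_addnP 0 a_gt0.
rewrite -[RHS]eq_a.
rewrite -[scanl _ _ _]/(partial_sums a) [in RHS](partial_sums_filter a).
congr pairmap; apply: eq_in_filter => i; rewrite mem_iota add1n ltnS => /andP[_].
rewrite leq_eqVlt; case: eqVneq => [|_ /= lt_in]; first by rewrite !orbT.
rewrite !orbF; apply/existsP/idP => [[j]|ai].
  by rewrite inE => /andP[aj /eqP <-].
by exists (Ordinal lt_in); rewrite inE ai /=.
Qed.

HB.instance Definition _ (n : nat) : isFinite (composition n) :=
  CanIsFinite (@descentsK n).

Lemma rev_is_composition (n : nat) (a : composition n) :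
  is_composition n (rev a).
Proof. by rewrite /is_composition all_rev sumn_rev; exact: partsP. Qed.

Definition comp_rev (n : nat) (a : composition n) : composition n :=
  Composition (rev_is_composition a).

Definition comp_compl (n : nat) (a : composition n) : composition n :=
  of_descents n (fun i => i \notin partial_sums a).

Lemma descents_compl (n : nat) (a : composition n) :
  descents (comp_compl a) = [set i : 'I_n | 0 < i] :\: descents a.
Proof.
by apply/setP=> i; rewrite descents_of_descents !inE andbC.
Qed.

Definition comp_conj (n : nat) (a : composition n) : composition n :=
  comp_rev (comp_compl a).

(* a <= b in refinement order: a is finer than b. *)
Definition comp_le (n : nat) (a b : composition n) : bool :=
  descents b \subset descents a.

Definition cstat (n : nat) (a b : composition n) : nat :=
  \sum_(i in descents a :&: descents b) (i : nat).

Definition nstat (n : nat) (a : composition n) : nat :=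
  \sum_(i in descents a) (i : nat).

Local Open Scope ring_scope.

(* The free associative K-algebra on the alphabet nat; the letter k is the
   generator h_(k+1). *)
Definition NSym (K : fieldType) : lalgType K := {malg K[{fmonom nat}]}.

(* h_0 = 1, as usual; the parts of a composition are positive. *)
Definition hgen (K : fieldType) (k : nat) : NSym K :=
  if k is k'.+1 then << fmu k' >> else 1.

Definition hcomp (K : fieldType) (n : nat) (a : composition n) : NSym K :=
  \prod_(k <- parts a) hgen K k.

Definition ribbon (K : fieldType) (n : nat) (a : composition n) : NSym K :=
  \sum_(b : composition n | comp_le a b)
    (-1) ^+ (size a - size b)%N *: hcomp K b.

Section Macdonald.
Variables (K : fieldType) (n : nat).
Implicit Types (a b g : composition n) (q t : K).

Definition macH a q t : NSym K :=
  \sum_(b : composition n)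
    (t ^+ cstat a (comp_compl b) * q ^+ cstat (comp_conj a) (comp_rev b))
      *: ribbon K b.

Definition macHt a q t : NSym K := t ^+ nstat a *: macH a q t^-1.

(* Meant for compositions a <= g. *)
Definition gribbon g a t : NSym K :=
  \sum_(b : composition n |
        comp_le a b && (descents a :\: descents b \subset descents g))
    t ^+ cstat a (comp_compl b) *: ribbon K b.

End Macdonald.

(* F has a nonnegative expansion in the g-Schur functions with parameter s.
   These, for b <= g, are linearly independent, as they are unitriangular on
   the ribbons R_b; hence the expansion is unique. *)
Definition gschur_positive (R : realType) (n : nat) (g : composition n)
    (s : Cqt R) (F : NSym (Cqt R)) : Prop :=
  exists2 c : composition n -> Cqt R,
    forall b, comp_le b g -> nonneg_int_poly (c b)
  & F = \sum_(b : composition n | comp_le b g) c b *: gribbon g b s.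

(* Main.v *)
Require Import Defs.
From mathcomp Require Import all_boot all_order all_algebra.
From mathcomp Require Import fraction reals.
From mathcomp Require Import zify.
From mathcomp.multinomials Require Import mpoly.
Import GRing.Theory.
Local Open Scope ring_scope.

(** Expanding the [gamma]-ribbons, the ribbon [R_delta] is reached from exactly
    one [beta <= gamma]: the conditions [D(gamma) <= D(beta)],
    [D(delta) <= D(beta)] and [D(beta) \ D(delta) <= D(gamma)] say that
    [D(beta) = D(delta) U D(gamma)].  Since [D(gamma) <= D(alpha)], the set
    [D(alpha) \ D(delta)] is the disjoint union of [D(alpha) \ D(beta)] and
    [D(beta) \ D(delta)], which gives the power of [t], whereas
    [D(beta) \ D(alpha) = D(delta) \ D(alpha)], which gives the power of [q]. *)

Lemma partial_sumsP (s : seq nat) (i : nat) :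
  reflect (exists2 k, (k < size s)%N & i = sumn (take k.+1 s))
          (i \in partial_sums s).
Proof.
have nth_scanl x (s' : seq nat) k : (k < size s')%N ->
    nth 0%N (scanl addn x s') k = (x + sumn (take k.+1 s'))%N.
  elim: s' x k => // y s' IHs x [|k] /= lt_ks; first by rewrite take0 addn0.
  by rewrite IHs // addnA.
apply: (iffP (nthP 0%N)); rewrite size_scanl => -[k lt_ks eq_i]; exists k => //.
  by rewrite -eq_i nth_scanl.
by rewrite nth_scanl // eq_i.
Qed.

Section Descents.
Variable n : nat.
Implicit Types a b c d g : composition n.

Lemma descents_inj : injective (@descents n).
Proof. exact: can_inj (@descentsK n). Qed.

Lemma partial_sums_gt0 a i : i \in partial_sums a -> (0 < i)%N.
Proof. by rewrite partial_sums_filter mem_filter mem_iota => /and3P[]. Qed.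

(** The first parts of the reverse are the last parts of [a], so the remaining parts form a prefix
    of [a] with sum [n - i]. *)
Lemma partial_sums_rev a i : (0 < i < n)%N ->
  i \in partial_sums (comp_rev a) -> (n - i)%N \in partial_sums a.
Proof.
have /andP[_ /eqP sum_a] := partsP a.
case/andP=> i_gt0 lt_in /partial_sumsP[k]; rewrite size_rev => lt_ka eq_i.
have sum_split : (sumn (take (size a - k.+1) a) + i)%N = n.
  by rewrite eq_i take_rev sumn_rev -sumn_cat cat_take_drop.
(* An empty prefix would force [i = n], against [i < n]. *)
apply/partial_sumsP; case E : (size a - k.+1)%N sum_split => [|j] sum_split.
  by rewrite take0 add0n in sum_split; rewrite sum_split ltnn in lt_in.
by exists j; lia.
Qed.

Lemma comp_revK : involutive (@comp_rev n).
Proof. by move=> a; apply: val_inj; rewrite /= revK. Qed.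

(** The relation [i + j = n] replaces [j = n - i], which leaves ['I_n] at [i = 0]; it makes both
    indices positive. *)
Lemma descents_rev a (i j : 'I_n) : (i + j)%N = n ->
  (i \in descents (comp_rev a)) = (j \in descents a).
Proof.
move=> eq_ij; have [i_gt0 j_gt0] : (0 < i)%N /\ (0 < j)%N.
  by move: (ltn_ord i) (ltn_ord j); lia.
rewrite !inE; apply/idP/idP => [|aj].
  move/partial_sums_rev; rewrite i_gt0 ltn_ord => /(_ isT).
  by have -> : (n - i)%N = j by lia.
have := @partial_sums_rev (comp_rev a) j.
rewrite comp_revK j_gt0 ltn_ord => /(_ isT aj).
by have -> : (n - j)%N = i by lia.
Qed.

(** The reflection [i -> n - i] carries D(a') to the complement of D(a), so the exponent of [q] only
    sees D(b) \ D(a). *)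
Lemma descents_rev_compl a b (i : 'I_n) :
  i \in descents (comp_conj a) -> i \in descents (comp_rev b) ->
  exists j : 'I_n, [/\ (i + j)%N = n, j \notin descents a & j \in descents b].
Proof.
move=> a'i bi; have i_gt0 : (0 < i)%N.
  by apply: partial_sums_gt0; rewrite inE in a'i; exact: a'i.
have lt_jn : (n - i < n)%N by move: (ltn_ord i); lia.
have eq_ij : (i + Ordinal lt_jn)%N = n by rewrite /= subnKC // ltnW.
exists (Ordinal lt_jn); split=> //; last by rewrite -(descents_rev _ _ _ eq_ij).
by move: a'i; rewrite (descents_rev _ _ _ eq_ij) descents_compl inE => /andP[].
Qed.

(** The greatest lower bound in refinement order: finer is smaller, so descent sets are united. *)
Definition comp_meet d g : composition n :=
  of_descents n (fun i => (i \in partial_sums d) || (i \in partial_sums g)).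

Lemma descents_meet d g : descents (comp_meet d g) = descents d :|: descents g.
Proof.
apply/setP=> i; rewrite descents_of_descents !inE andb_idl //.
by case/orP; exact: partial_sums_gt0.
Qed.

Lemma comp_meet_unique b d g :
  [&& comp_le b g, comp_le b d & descents b :\: descents d \subset descents g]
    = (b == comp_meet d g).
Proof.
rewrite -(inj_eq descents_inj) descents_meet eqEsubset subUset /comp_le.
(* The last condition is the inclusion of D(b) in the union of D(d) and D(g), the first two the
   reverse one. *)
by rewrite subDset andbA [RHS]andbC; congr (_ && _); exact: andbC.
Qed.

Lemma cstat_complr a b :
  cstat a (comp_compl b) = (\sum_(i in descents a :\: descents b) i)%N.
Proof.
apply: eq_bigl => i; rewrite descents_compl !inE [RHS]andbC.
by apply: andb_id2l => /partial_sums_gt0 ->; rewrite andbT.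
Qed.

Lemma cstat_compl_add a b : (cstat a b + cstat a (comp_compl b))%N = nstat a.
Proof. by rewrite cstat_complr /nstat [RHS](big_setID (descents b)). Qed.

Lemma cstat_meet_t a d g : comp_le a g ->
  (cstat a (comp_compl (comp_meet d g)) + cstat (comp_meet d g) (comp_compl d)
     = cstat a (comp_compl d))%N.
Proof.
move/subsetP=> le_ag; rewrite !cstat_complr descents_meet.
(* Cut D(a) \ D(d) along D(g): as D(a) contains D(g), the part inside is D(g) \ D(d). *)
rewrite [RHS](big_setID (descents g)) addnC; congr (_ + _)%N; apply: eq_bigl => i.
  rewrite !(in_setD, in_setU, in_setI); have := le_ag i.
  by case: (i \in descents g) => [->|]; case: (i \in descents d); rewrite ?andbF.
by rewrite !(in_setD, in_setU) negb_or -andbA andbCA.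
Qed.

Lemma cstat_meet_q a d g : comp_le a g ->
  cstat (comp_conj a) (comp_rev (comp_meet d g)) =
  cstat (comp_conj a) (comp_rev d).
Proof.
move/subsetP=> le_ag; apply: eq_bigl => i; rewrite !in_setI.
apply: andb_id2l => a'i; apply/idP/idP => bi.
  have [j [eq_ij aj]] := descents_rev_compl _ _ _ a'i bi.
  (* Since [j] is outside D(a), it cannot come from D(g). *)
  rewrite descents_meet in_setU (descents_rev _ _ _ eq_ij) => /orP[//|/le_ag].
  by rewrite (negPf aj).
have [j [eq_ij _]] := descents_rev_compl _ _ _ a'i bi.
by rewrite (descents_rev _ _ _ eq_ij) descents_meet in_setU => ->.
Qed.

(* Stated for an arbitrary family [r] in an abstract module because rewriting
   under sums fails in [NSym K], whose carrier gets unfolded. *)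
Lemma sum_comp_meet (K : fieldType) (V : lmodType K) (r : composition n -> V)
    a g (q t : K) : comp_le a g ->
  \sum_b (t ^+ cstat a (comp_compl b)
            * q ^+ cstat (comp_conj a) (comp_rev b)) *: r b =
  \sum_(b | comp_le b g)
    (t ^+ cstat a (comp_compl b) * q ^+ cstat (comp_conj a) (comp_rev b))
      *: \sum_(d | comp_le b d && (descents b :\: descents d \subset descents g))
           t ^+ cstat b (comp_compl d) *: r d.
Proof.
move=> le_ag; under [RHS]eq_bigr do rewrite scaler_sumr.
(* Compare the coefficients of each [r d]; only [b = comp_meet d g] contributes. *)
rewrite (exchange_big_dep xpredT) //=; apply: eq_bigr => d _.
under eq_bigl do rewrite comp_meet_unique.
rewrite big_pred1_eq scalerA mulrAC -exprD cstat_meet_t //.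
by rewrite cstat_meet_q.
Qed.

Lemma macH_gribbon (K : fieldType) a g (q t : K) : comp_le a g ->
  macH a q t =
    \sum_(b : composition n | comp_le b g)
      (t ^+ cstat a (comp_compl b) * q ^+ cstat (comp_conj a) (comp_rev b))
        *: gribbon g b t.
Proof. exact: sum_comp_meet. Qed.

(** Substitute [t^-1] in the expansion of [macH]; the factor [t ^+ nstat a] turns each c(a, b^c)
    into c(a, b). *)
Lemma macHt_gribbon (K : fieldType) a g (q t : K) : t != 0 -> comp_le a g ->
  macHt a q t =
    \sum_(b : composition n | comp_le b g)
      (t ^+ cstat a b * q ^+ cstat (comp_conj a) (comp_rev b))
        *: gribbon g b t^-1.
Proof.
move=> t_neq0 le_ag; rewrite /macHt (macH_gribbon _ _ _ _ _ le_ag) scaler_sumr.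
apply: eq_bigr => b _; rewrite scalerA mulrA exprVn -(cstat_compl_add a b).
by rewrite exprD mulfK // expf_neq0.
Qed.

End Descents.

Lemma tvar_neq0 (R : realType) : tvar R != 0.
Proof. by rewrite tofrac_eq0 -msupp_eq0 msuppX. Qed.

Lemma nonneg_int_poly_monomial (R : realType) (i j : nat) :
  nonneg_int_poly (tvar R ^+ i * qvar R ^+ j).
Proof.
pose m := (U_(ord_max) *+ i + U_(ord0) *+ j)%MM : 'X_{1..2}.
exists 'X_[m]; first by rewrite mpolyXD -!mpolyXn tofracM !tofracXn.
by move=> m'; rewrite mcoeffX; exists (m == m').
Qed.

Theorem theorem14 (R : realType) (n : nat) (alpha gamma : composition n)
    (le_alpha_gamma : comp_le alpha gamma) :
  let q := qvar R in
  let t := tvar R in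
  [/\ gschur_positive gamma t (macH alpha q t),
      gschur_positive gamma t^-1 (macHt alpha q t),
      macH alpha q t =
        \sum_(beta : composition n | comp_le beta gamma)
          (t ^+ cstat alpha (comp_compl beta)
             * q ^+ cstat (comp_conj alpha) (comp_rev beta))
            *: gribbon gamma beta t
    & macHt alpha q t =
        \sum_(beta : composition n | comp_le beta gamma)
          (t ^+ cstat alpha beta
             * q ^+ cstat (comp_conj alpha) (comp_rev beta))
            *: gribbon gamma beta t^-1].
Proof.
move=> q t.
have eqH := macH_gribbon n _ alpha gamma q t le_alpha_gamma.
have eqHt := macHt_gribbon n _ alpha gamma q t (tvar_neq0 R) le_alpha_gamma.
(* The coefficients witnessing positivity are read off the two expansions. *)
split; [apply: ex_intro2 eqH|apply: ex_intro2 eqHt|exact: eqH|exact: eqHt] => b _;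
  exact: nonneg_int_poly_monomial.
Qed.
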